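(* Let $u_1,u_2,u_3,u_4\in\mathbf C$ with $\Re u_i>1$ for $i=1,2,3,4$. Then $$\begin{aligned}\int_0^1\prod_{i=1}^4\zeta_1(u_i,\alpha)\,d\alpha={}&\frac{1}{u_1+u_2+u_3+u_4-1}+\sum_{j=1}^4\int_1^\infty\alpha^{-\sum_{i\ne j}u_i}\,\zeta_1(u_j,\alpha)\,d\alpha\\&+\sum_{1\le j<k\le 4}\int_1^\infty\alpha^{-\sum_{i\ne j,k}u_i}\,\zeta_1(u_j,\alpha)\,\zeta_1(u_k,\alpha)\,d\alpha+\sum_{j=1}^4\int_1^\infty\alpha^{-u_j}\prod_{i\ne j}\zeta_1(u_i,\alpha)\,d\alpha ,\end{aligned}$$ where in all inner sums and products the index $i$ ranges over the elements of $\{1,2,3,4\}$ satisfying the indicated condition (so the three sums have $4$, $6$ and $4$ terms respectively).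
   Context: The modified Hurwitz zeta function is $\zeta_1(s,\alpha)=\sum_{m=1}^\infty (m+\alpha)^{-s}=\frac{1}{\Gamma(s)}\int_0^\infty\frac{e^{-\alpha\rho}\rho^{s-1}}{e^\rho-1}\,d\rho$ for $\alpha>0$, $\Re s>1$. *)

(* Defs.v *)
(* Stdlib reals with Coquelicot; MathComp only provides the finite index type
   and the finite sums and products over it. *)
From Stdlib Require Import Reals.
From Coquelicot Require Import Coquelicot.
From mathcomp Require Import all_boot.

Set Implicit Arguments.
Unset Strict Implicit.
Unset Printing Implicit Defensive.

Local Open Scope R_scope.

Notation "\sum_ ( i < n ) F" :=
  (\big[Cplus/RtoC 0]_(i < n) F%C) : C_scope.
Notation "\sum_ ( i < n | P ) F" :=
  (\big[Cplus/RtoC 0]_(i < n | P%B) F%C) : C_scope.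
Notation "\prod_ ( i < n ) F" :=
  (\big[Cmult/RtoC 1]_(i < n) F%C) : C_scope.
Notation "\prod_ ( i < n | P ) F" :=
  (\big[Cmult/RtoC 1]_(i < n | P%B) F%C) : C_scope.

Definition Cexp (z : C) : C :=
  (exp (Re z) * cos (Im z), exp (Re z) * sin (Im z)).

(* The principal power x^s of a real base; meaningful only for 0 < x, since
   Stdlib's ln is 0 on nonpositive arguments. *)
Definition Cpower (x : R) (s : C) : C := Cexp (s * RtoC (ln x))%C.

(* sum_(m >= 1) (m + a)^(-s), with m = n + 1. Series being real-valued, the sum
   is taken componentwise, which is the same as in C; as Series is total, the
   value is meaningful only when the series converges (-1 < a, 1 < Re s). *)
Definition zeta1 (s : C) (a : R) : C :=
  let term (n : nat) := Cpower (INR n.+1 + a) (- s)%C in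
  (Series (fun n => Re (term n)), Series (fun n => Im (term n))).

(* Integrals over [0, 1] and improper integrals over [1, +oo) of complex-valued
   functions of a real variable, C being seen as a normed space over R. *)
Definition ex_CInt01 (f : R -> C) : Prop :=
  ex_RInt (V := C_R_NormedModule) f 0 1.

Definition CInt01 (f : R -> C) : C :=
  RInt (V := C_R_CompleteNormedModule) f 0 1.

Definition ex_CInt1oo (f : R -> C) : Prop :=
  ex_RInt_gen (V := C_R_NormedModule) f (at_point 1) (Rbar_locally p_infty).

Definition CInt1oo (f : R -> C) : C :=
  RInt_gen (V := C_R_CompleteNormedModule) f
    (at_point 1) (Rbar_locally p_infty).

(* Main.v *)
(* Since zeta1(s, a - 1) = a^(-s) + zeta1(s, a), the product F of the four zeta
   functions satisfies F(a - 1) = prod_i (a^(-u_i) + zeta1(u_i, a)); expanding,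
   F(a - 1) - F(a) is the sum of all the integrands on the right-hand side,
   a^(-(u_1 + ... + u_4)) included. As F tends to 0 at infinity, the integral
   of F(a - 1) - F(a) over [1, oo) is that of F over [0, 1]. Each integrand
   carries a factor a^(-s) with Re s > 1 and its other factors are bounded, so
   the integrals converge separately. *)
Require Import Defs.
From HB Require Import structures.
From Stdlib Require Import Reals Lra.
From Coquelicot Require Import Coquelicot.
From mathcomp Require Import all_boot.

Set Implicit Arguments.
Unset Strict Implicit.

Local Open Scope R_scope.

(** * Real powers: primitive, decay at infinity and comparison series *)

Lemma Rpower_le_base (p x y : R) :
  0 <= p -> 0 < x <= y -> Rpower y (- p) <= Rpower x (- p).
Proof.
move=> hp [hx hxy]; rewrite !Rpower_Ropp.
apply: Rinv_le_contravar; first exact: exp_pos.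
exact: Rle_Rpower_l.
Qed.

Lemma is_derive_Rpower_primitive (p x : R) : 1 < p -> 0 < x ->
  is_derive (fun y => - (Rpower y (1 - p) / (p - 1))) x (Rpower x (- p)).
Proof.
move=> hp hx; rewrite /Rpower; auto_derive; first by [].
have -> : - p * ln x = (1 - p) * ln x - ln x by ring.
rewrite exp_plus exp_Ropp exp_ln //; field; lra.
Qed.

Lemma continuous_Rpower (p x : R) : 0 < x -> continuous (fun y => Rpower y p) x.
Proof.
move=> hx; apply: ex_derive_continuous; rewrite /Rpower; auto_derive; lra.
Qed.

Lemma is_RInt_Rpower (p a b : R) : 1 < p -> 0 < a <= b ->
  is_RInt (fun x => Rpower x (- p)) a b
    (- (Rpower b (1 - p) / (p - 1)) - - (Rpower a (1 - p) / (p - 1))).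
Proof.
move=> hp [ha hab].
apply: (is_RInt_derive (fun y => - (Rpower y (1 - p) / (p - 1)))) => x;
  rewrite (Rmin_left _ _ hab) (Rmax_right _ _ hab) => -[hx _].
  by apply: is_derive_Rpower_primitive => //; lra.
by apply: continuous_Rpower; lra.
Qed.

Lemma is_lim_Rpower_neg (p : R) : p < 0 ->
  filterlim (fun x => Rpower x p) (Rbar_locally p_infty) (locally 0).
Proof.
move=> hp.
apply: (filterlim_comp _ _ _ (fun x => p * ln x) exp _ (Rbar_locally m_infty)).
  have h : is_lim (fun x => p * ln x) p_infty m_infty.
    have := is_lim_scal_l ln p p_infty p_infty is_lim_ln_p.
    rewrite /Rbar_mult /=; case: Rle_dec => [h|_]; last by [].
    by exfalso; lra.
  exact: h.
exact: is_lim_exp_m.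
Qed.

Lemma is_lim_Rpower_primitive (p : R) : 1 < p ->
  filterlim (fun x => - (Rpower x (1 - p) / (p - 1))) (Rbar_locally p_infty)
    (locally 0).
Proof.
move=> hp.
have -> : 0 = scal (- / (p - 1)) 0 by rewrite /scal /= /mult /=; ring.
apply: (filterlim_ext (fun x => scal (- / (p - 1)) (Rpower x (1 - p)))).
  by move=> x; rewrite /scal /= /mult /=; field; lra.
apply: filterlim_comp (filterlim_scal_r _ _).
by apply: is_lim_Rpower_neg; lra.
Qed.

(** The partial sum up to [n] collapses to [v 0 - v n.+1]. *)
Lemma is_series_telescope (v : nat -> R) :
  is_lim_seq v 0 -> is_series (fun n => v n - v n.+1) (v 0%N).
Proof.
move=> hv.
apply: (filterlim_ext (fun n => v 0%N - v n.+1)).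
  elim=> [|n IH]; first by rewrite sum_O.
  by rewrite sum_Sn -IH /plus /=; ring.
suff: is_lim_seq (fun n => v 0%N - v n.+1) (v 0%N) by [].
rewrite -{2}(Rminus_0_r (v 0%N)).
apply: is_lim_seq_minus'; first exact: is_lim_seq_const.
exact: (is_lim_seq_incr_1 v 0).1 hv.
Qed.

(** The integral test over one unit step: by the mean value theorem the right-hand side equals
    [Rpower c (- p)] for some [c] in [[x, x + 1]], and this power decreases with its base. *)
Lemma Rpower_le_telescope (p x : R) : 1 < p -> 0 < x ->
  Rpower (x + 1) (- p)
    <= Rpower x (1 - p) / (p - 1) - Rpower (x + 1) (1 - p) / (p - 1).
Proof.
move=> hp hx.
have hm : x <= x + 1 by lra.
case: (MVT_gen (fun y => - (Rpower y (1 - p) / (p - 1))) x (x + 1)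
  (fun y => Rpower y (- p))).
- move=> y; rewrite (Rmin_left _ _ hm) (Rmax_right _ _ hm) => hy.
  by apply: is_derive_Rpower_primitive => //; lra.
- move=> y; rewrite (Rmin_left _ _ hm) (Rmax_right _ _ hm) => hy.
  apply/continuity_pt_filterlim/ex_derive_continuous; eexists.
  by apply: (is_derive_Rpower_primitive hp); lra.
move=> c; rewrite (Rmin_left _ _ hm) (Rmax_right _ _ hm) => -[hc e].
have : Rpower (x + 1) (- p) <= Rpower c (- p) by apply: Rpower_le_base; lra.
lra.
Qed.

Lemma series_Rpower_telescope (p a : R) : 1 < p -> 0 < a ->
  is_series (fun n => Rpower (INR n + a) (1 - p) / (p - 1)
                      - Rpower (INR n.+1 + a) (1 - p) / (p - 1))
    (Rpower a (1 - p) / (p - 1)).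
Proof.
move=> hp ha.
have := is_series_telescope (v := fun n => Rpower (INR n + a) (1 - p) / (p - 1)).
rewrite /= Rplus_0_l; apply.
have h : is_lim_seq (fun n => INR n + a) p_infty.
  by apply: is_lim_seq_plus is_lim_seq_INR (is_lim_seq_const a) _.
have h2 := filterlim_comp _ _ _ _ _ _ _ _ h (is_lim_Rpower_primitive hp).
have := proj1 (is_lim_seq_opp _ (Rbar.Finite 0)) h2.
by rewrite /= Ropp_0; apply: is_lim_seq_ext => n; ring.
Qed.

Lemma Rpower_term_le_telescope (p a : R) (n : nat) : 1 < p -> 0 < a ->
  0 <= Rpower (INR n.+1 + a) (- p)
    <= Rpower (INR n + a) (1 - p) / (p - 1)
       - Rpower (INR n.+1 + a) (1 - p) / (p - 1).
Proof.
move=> hp ha; split; first by apply: Rlt_le; apply: exp_pos.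
have -> : INR n.+1 + a = INR n + a + 1 by rewrite S_INR; ring.
by apply: Rpower_le_telescope => //; have := pos_INR n; lra.
Qed.

Lemma ex_series_Rpower (p a : R) : 1 < p -> -1 < a ->
  ex_series (fun n => Rpower (INR n.+1 + a) (- p)).
Proof.
(* The comparison series needs a positive parameter, while [a] may lie in [(-1, 0]]. Dropping the
   first term replaces [a] by [a + 1]. *)
move=> hp ha; apply/ex_series_incr_1.
apply: (ex_series_ext (fun n => Rpower (INR n.+1 + (a + 1)) (- p))).
  by move=> n; congr Rpower; rewrite (S_INR n.+1); ring.
have ha1 : 0 < a + 1 by lra.
apply: ex_series_le (ex_intro _ _ (series_Rpower_telescope hp ha1)) => n.
have [h0 h1] := Rpower_term_le_telescope n hp ha1.
by rewrite /norm /= /abs /= Rabs_pos_eq.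
Qed.

(** Termwise comparison with the telescoping series. The explicit bound tends to 0 as [a] grows,
    which later gives the decay of [zeta1]. *)
Lemma Series_Rpower_le (p a : R) : 1 < p -> 0 < a ->
  Series (fun n => Rpower (INR n.+1 + a) (- p)) <= Rpower a (1 - p) / (p - 1).
Proof.
move=> hp ha; rewrite -(is_series_unique _ _ (series_Rpower_telescope hp ha)).
apply: Series_le; last by eexists; exact: series_Rpower_telescope.
by move=> n; exact: Rpower_term_le_telescope.
Qed.

(** * Continuity of dominated series of functions *)

Lemma continuous_Series (f : nat -> R -> R) (M : nat -> R) (D : R -> Prop) :
  open D -> ex_series M ->
  (forall n x, D x -> Rabs (f n x) <= M n) ->
  (forall n x, D x -> continuous (f n) x) ->
  forall x, D x -> continuous (fun y => Series (fun n => f n y)) x.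
Proof.
move=> oD exM le_fM cont_f x Dx; apply/continuity_pt_filterlim.
(* Weierstrass M-test: the partial sums are continuous and converge uniformly on [D], because each
   remainder is at most the remainder of [M], which does not depend on [y]. *)
apply: (CVU_cont_open (fun n y => sum_n (fun k => f k y) n) D) => // [eps|n y Dy].
  have exf y (Dy : D y) : ex_series (fun n => Rabs (f n y)).
    apply: ex_series_le exM => n.
    by rewrite /norm /= /abs /= Rabs_Rabsolu; exact: le_fM.
  have /filterlim_locally/(_ eps) [N hN] := Series_correct _ exM.
  exists N => n leNn y Dy; have exfy := exf y Dy.
  have := hN n leNn; rewrite /ball /= /AbsRing_ball /abs /= /minus /plus /opp /=.
  (* Splitting both series after index [n] turns both errors into tails: [T] for [f], [S] for
     [M]. *)
  have split_at (a : nat -> R) : ex_series a ->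
      Series a = sum_n a n + Series (fun k => a (n.+1 + k)%N).
    move=> ha; rewrite (Series_incr_n a n.+1) ?sum_n_Reals //.
    exact/Nat.lt_0_succ.
  rewrite -/(Series (fun k => f k y)) (split_at (fun k => f k y));
    last exact: ex_series_Rabs.
  rewrite (split_at _ exM) => hM.
  set S := Series _ in hM *; set T := Series _.
  have exM' : ex_series (fun k => M (n.+1 + k)%N).
    exact: (proj1 (ex_series_incr_n M n.+1) exM).
  have exf' : ex_series (fun k => Rabs (f (n.+1 + k)%N y)).
    exact: (proj1 (ex_series_incr_n (fun k => Rabs (f k y)) n.+1) exfy).
  have hT : Rabs T <= S.
    apply: Rle_trans (Series_Rabs _ exf') _; apply: Series_le => // k.
    by split; [exact: Rabs_pos|exact: le_fM].
  have -> : sum_n (fun k => f k y) n - (sum_n (fun k => f k y) n + T) = - T by ring.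
  rewrite Rabs_Ropp; apply: Rle_lt_trans hT _; move: hM.
  have -> : sum_n M n + - (sum_n M n + S) = - S by ring.
  by move=> /Rabs_def2; lra.
apply/continuity_pt_filterlim.
suff: continuous (fun z => sum_n (fun k => f k z) n : R) y by [].
elim: n => [|n IH].
  by apply: continuous_ext (cont_f 0%N y Dy) => z; rewrite sum_O.
apply: (continuous_ext (fun z => sum_n (fun k => f k z) n + f n.+1 z)).
  by move=> z; rewrite sum_Sn.
by apply: (continuous_plus (V := R_NormedModule)) => //; exact: cont_f.
Qed.

(** * Improper integrals over a half-line *)

Lemma is_RInt_gen_p_infty (V : NormedModule R_AbsRing) (f F : R -> V) (a : R)
    (l : V) :
  (forall b, a <= b -> is_RInt f a b (F b)) ->
  filterlim F (Rbar_locally p_infty) (locally l) ->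
  is_RInt_gen f (at_point a) (Rbar_locally p_infty) l.
Proof.
move=> hF lim; apply: (filterlimi_lim_ext_loc (fun ab : R * R => F ab.2)).
  exists (fun x => x = a) (fun y => a <= y) => //.
    by exists a => x; lra.
  by move=> x y -> hy; exact: hF.
by apply: filterlim_comp lim; exact: filterlim_snd.
Qed.

(** Cauchy criterion: the integral of [f] over [[x, y]] has norm at most [G y - G x], which is small
    for large [x] and [y] since [G] converges. Completeness of [V] then provides the limit. *)
Lemma ex_RInt_gen_dominated (V : CompleteNormedModule R_AbsRing) (f : R -> V)
    (g G : R -> R) (a l : R) :
  (forall b, a <= b -> ex_RInt f a b) ->
  (forall x, a <= x -> norm (f x) <= g x) ->
  (forall x y, a <= x <= y -> is_RInt g x y (G y - G x)) ->
  filterlim G (Rbar_locally p_infty) (locally l) ->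
  ex_RInt_gen f (at_point a) (Rbar_locally p_infty).
Proof.
move=> exf le_fg intg limG.
suff [L hL] : exists L, filterlim (fun b => RInt f a b) (Rbar_locally p_infty)
    (locally L).
  exists L; apply: is_RInt_gen_p_infty hL => b hb.
  exact/RInt_correct/exf.
apply/filterlim_locally_cauchy => eps.
have /filterlim_locally/(_ (pos_div_2 eps)) [X hX] := limG.
exists (fun x => Rmax a X < x); split; first by exists (Rmax a X).
(* The ordered case suffices, the ball relation being symmetric. Both [G x] and [G y] lie within
   [eps / 2] of [l]. *)
have close x y : Rmax a X < x -> x <= y ->
    norm (minus (RInt f a y) (RInt f a x)) < eps.
  move=> hx hxy; have [hax hXx] := (Rmax_l a X, Rmax_r a X).
  have exxy : ex_RInt f x y.
    by apply: (ex_RInt_Chasles_2 _ a); [lra|apply: exf; lra].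
  rewrite -(RInt_Chasles f a x y) //; last by apply: exf; lra.
  rewrite /minus (plus_comm (RInt f a x)) -plus_assoc plus_opp_r plus_zero_r.
  apply: (Rle_lt_trans _ (G y - G x)).
    apply: (norm_RInt_le f g x y) => //; first by move=> z hz; apply: le_fg; lra.
      exact: RInt_correct.
    by apply: intg; lra.
  have := hX x ltac:(lra); have := hX y ltac:(lra).
  rewrite /ball /= /AbsRing_ball /abs /minus /plus /opp /=.
  by move=> /Rabs_def2 h1 /Rabs_def2 h2; lra.
move=> x y hx hy; case: (Rle_dec x y) => hxy.
  by apply: norm_compat1; exact: close.
by apply: ball_sym; apply: norm_compat1; apply: close => //; lra.
Qed.

(* The integrals of [F] over [[0, b - 1]] and [[1, b]] differ by those over the
   end intervals [[0, 1]] and [[b - 1, b]], and the latter tends to [0]. *)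
Lemma is_RInt_gen_unit_shift (V : CompleteNormedModule R_AbsRing) (F : R -> V) :
  (forall a, 0 <= a -> continuous F a) ->
  filterlim (fun a => norm (F a)) (Rbar_locally p_infty) (locally 0) ->
  is_RInt_gen (fun a => minus (F (a - 1)) (F a)) (at_point 1)
    (Rbar_locally p_infty) (RInt F 0 1).
Proof.
move=> contF limF.
have exF x y : 0 <= x <= y -> ex_RInt F x y.
  move=> hxy; apply: ex_RInt_continuous => z; rewrite Rmin_left; last lra.
  by move=> hz; apply: contF; lra.
apply: (is_RInt_gen_p_infty (F := fun b => minus (RInt F 0 1) (RInt F (b - 1) b))).
  move=> b hb.
  have -> : minus (RInt F 0 1) (RInt F (b - 1) b)
      = minus (RInt F 0 (b - 1)) (RInt F 1 b).
    have e : plus (RInt F 0 1) (RInt F 1 b)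
        = plus (RInt F 0 (b - 1)) (RInt F (b - 1) b).
      by rewrite !RInt_Chasles //; apply: exF; lra.
    (* Adding both subtracted integrals to each side leaves [e], the two ways of cutting
       [[0, b]]. *)
    apply: (plus_reg_r (plus (RInt F (b - 1) b) (RInt F 1 b))).
    rewrite {1}/minus -plus_assoc (plus_assoc (opp _)) plus_opp_l plus_zero_l e.
    rewrite (plus_comm (RInt F (b - 1) b)) /minus -plus_assoc.
    by rewrite (plus_assoc (opp _)) plus_opp_l plus_zero_l.
  apply: is_RInt_minus; last by apply: RInt_correct; apply: exF; lra.
  (* The substitution [x = a - 1], written as the affine map with slope 1 and offset -1. *)
  have := is_RInt_comp_lin F 1 (-1) 1 b (RInt F 0 (b - 1)).
  have -> : 1 * 1 + -1 = 0 by ring.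
  have -> : 1 * b + -1 = b - 1 by ring.
  move=> /(_ (RInt_correct _ _ _ (exF 0 (b - 1) ltac:(lra)))).
  apply: is_RInt_ext => x _; rewrite scal_one; congr F; rewrite /one /=; ring.
rewrite -{2}(plus_zero_r (RInt F 0 1)) -opp_zero.
apply: (filterlim_comp_2 (fun=> RInt F 0 1) (fun b => opp (RInt F (b - 1) b)) plus
  (filterlim_const _) _ (filterlim_plus _ _)).
apply: filterlim_comp (filterlim_opp _).
apply: filterlim_norm_zero; apply/filterlim_locally => eps.
have /filterlim_locally/(_ (pos_div_2 eps)) [X hX] := limF.
exists (Rmax X 0 + 1) => b hb; have [hX1 hX2] := (Rmax_l X 0, Rmax_r X 0).
(* Beyond [X] the norm of [F] is below [eps / 2], and the interval has length 1. *)
have h : norm (RInt F (b - 1) b) <= scal (b - (b - 1)) (eps / 2).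
  apply: (norm_RInt_le F (fun=> eps / 2) (b - 1) b); first lra.
  - move=> x hx; have := hX x ltac:(lra).
    rewrite /ball /= /AbsRing_ball /abs /minus /plus /opp /=.
    by move=> /Rabs_def2 ?; lra.
  - by apply: RInt_correct; apply: exF; lra.
  exact: is_RInt_const.
rewrite /ball /= /AbsRing_ball /abs /minus /plus /opp /=.
move: h; rewrite /scal /= /mult /= => h.
have := norm_ge_0 (RInt F (b - 1) b); have := cond_pos eps => h0 h1.
by apply: Rabs_def1; lra.
Qed.

(** * Continuity of complex-valued functions through their components *)

Lemma continuous_to_C (f : R -> C) (x : R) :
  continuous (fun y => Re (f y)) x -> continuous (fun y => Im (f y)) x ->
  continuous (f : R -> C_UniformSpace) x.
Proof.
move=> cRe cIm.
apply: (continuous_ext (fun y => (Re (f y), Im (f y)) : C_UniformSpace)).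
  by move=> y; rewrite -surjective_pairing.
apply: (continuous_comp_2 (fun y => Re (f y)) (fun y => Im (f y))
  (fun a b => (a, b) : C_UniformSpace)) => //.
apply: (continuous_ext (fun z : prod_UniformSpace _ _ => z)).
  by move=> z; rewrite -surjective_pairing.
exact: continuous_id.
Qed.

Lemma continuous_Re (f : R -> C) (x : R) :
  continuous (f : R -> C_UniformSpace) x -> continuous (fun y => Re (f y)) x.
Proof.
move=> cf; apply: (continuous_comp f (fst : C_UniformSpace -> R)) => //.
rewrite (surjective_pairing (f x)); exact: continuous_fst.
Qed.

Lemma continuous_Im (f : R -> C) (x : R) :
  continuous (f : R -> C_UniformSpace) x -> continuous (fun y => Im (f y)) x.
Proof.
move=> cf; apply: (continuous_comp f (snd : C_UniformSpace -> R)) => //.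
rewrite (surjective_pairing (f x)); exact: continuous_snd.
Qed.

Lemma continuous_Cmult (f g : R -> C) (x : R) :
  continuous (f : R -> C_UniformSpace) x ->
  continuous (g : R -> C_UniformSpace) x ->
  continuous (fun y => Cmult (f y) (g y) : C_UniformSpace) x.
Proof.
move=> cf cg.
have [[cf1 cf2] [cg1 cg2]] := ((continuous_Re cf, continuous_Im cf),
  (continuous_Re cg, continuous_Im cg)).
apply: continuous_to_C => /=.
  apply: (continuous_minus (V := R_NormedModule));
    exact: (continuous_mult (K := R_AbsRing)).
apply: (continuous_plus (V := R_NormedModule));
  exact: (continuous_mult (K := R_AbsRing)).
Qed.

(** * Powers of a real base with complex exponent *)

Lemma Cexp_plus (z w : C) : Cexp (z + w)%C = (Cexp z * Cexp w)%C.
Proof.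
rewrite /Cexp /Cmult /Re /Im /= exp_plus cos_plus sin_plus.
by congr pair; ring.
Qed.

Lemma Cpower_plus (a : R) (s t : C) :
  Cpower a (s + t)%C = (Cpower a s * Cpower a t)%C.
Proof. by rewrite /Cpower Cmult_plus_distr_r Cexp_plus. Qed.

Lemma Cpower_0 (a : R) : Cpower a (RtoC 0) = RtoC 1.
Proof.
by rewrite /Cpower Cmult_0_l /Cexp /= exp_0 cos_0 sin_0 /RtoC; congr pair; ring.
Qed.

Lemma CpowerE (a : R) (s : C) : Cpower a s =
  (Rpower a (Re s) * cos (Im s * ln a), Rpower a (Re s) * sin (Im s * ln a)).
Proof.
rewrite /Cpower /Cexp /Rpower /=.
have -> : Re s * ln a - Im s * 0 = Re s * ln a by ring.
by have -> : Re s * 0 + Im s * ln a = Im s * ln a by ring.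
Qed.

Lemma Cmod_Cpower (a : R) (s : C) : Cmod (Cpower a s) = Rpower a (Re s).
Proof.
rewrite CpowerE /Cmod /=; set r := Rpower _ _; set t := Im s * _.
have -> : r * cos t * (r * cos t * 1) + r * sin t * (r * sin t * 1)
   = r * r * (Rsqr (sin t) + Rsqr (cos t)) by rewrite /Rsqr; ring.
by rewrite sin2_cos2 Rmult_1_r sqrt_square //; apply/Rlt_le/exp_pos.
Qed.

Lemma continuous_Cpower (s : C) (a : R) : 0 < a ->
  continuous (fun x => Cpower x s : C_UniformSpace) a.
Proof.
move=> ha; apply: continuous_to_C; apply: ex_derive_continuous;
  rewrite /Cpower /=; auto_derive; lra.
Qed.

(** The rule [(k x^s)' = k s x^(s-1)], by components so that the real fundamental theorem of
    calculus applies to each. The factor [k] makes room for the constant of a primitive. *)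
Lemma is_derive_Cpower_comp (s k : C) (x : R) : 0 < x ->
  is_derive (fun y => Re (k * Cpower y s)%C) x
     (Re (k * s * Cpower x (s - RtoC 1)))%C /\
  is_derive (fun y => Im (k * Cpower y s)%C) x
     (Im (k * s * Cpower x (s - RtoC 1)))%C.
Proof.
move=> hx.
(* This leaves the same exponential, cosine and sine on both sides of the derivative formulas, which
   then become rational identities. *)
have e : Cpower x (s - RtoC 1)%C = (RtoC (/ x) * Cpower x s)%C.
  rewrite /Cminus Cpower_plus Cmult_comm; congr Cmult.
  rewrite CpowerE /= /Rpower Ropp_0 Rmult_0_l cos_0 sin_0.
  by rewrite -Ropp_mult_distr_l Rmult_1_l exp_Ropp exp_ln // Rmult_1_r Rmult_0_r.
rewrite e; split; rewrite /Cpower /Cexp /=; auto_derive; try by [];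
 set u := exp _; set v := cos _; set w := sin _; field; lra.
Qed.

Lemma is_RInt_Cpower (s : C) (a b : R) : s <> RtoC 1 -> 0 < a <= b ->
  is_RInt (V := C_R_NormedModule) (fun x => Cpower x (- s)%C) a b
   ((Cpower b (RtoC 1 - s) - Cpower a (RtoC 1 - s)) / (RtoC 1 - s))%C.
Proof.
move=> hs [ha hab].
have hs1 : (RtoC 1 - s)%C <> RtoC 0.
  by move=> h; apply: hs; rewrite -[s]Cplus_0_r -h; ring.
(* With this factor the derivative of [k x^(1-s)] is exactly [x^(-s)]. *)
set k := (/ (RtoC 1 - s))%C.
have key x : (k * (RtoC 1 - s) * Cpower x (RtoC 1 - s - RtoC 1) = Cpower x (- s))%C.
  have -> : (RtoC 1 - s - RtoC 1 = - s)%C by ring.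
  by rewrite /k Cinv_l // Cmult_1_l.
have -> : ((Cpower b (RtoC 1 - s) - Cpower a (RtoC 1 - s)) / (RtoC 1 - s))%C
  = (Re (k * Cpower b (RtoC 1 - s))%C - Re (k * Cpower a (RtoC 1 - s))%C,
     Im (k * Cpower b (RtoC 1 - s))%C - Im (k * Cpower a (RtoC 1 - s))%C).
  rewrite /Cdiv -/k; move: (Cpower b _) (Cpower a _) (k) => [p1 p2] [q1 q2] [k1 k2].
  by rewrite /Cmult /Cminus /Cplus /Copp /=; congr pair; ring.
apply: (is_RInt_fct_extend_pair (U := R_NormedModule) (V := R_NormedModule)).
  apply: (is_RInt_derive (fun y => Re (k * Cpower y (RtoC 1 - s))%C)) => x;
    rewrite Rmin_left // Rmax_right // => hx.
    have := proj1 (is_derive_Cpower_comp (RtoC 1 - s)%C k (x := x) ltac:(lra)).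
    by rewrite key.
  by apply: (continuous_Re (f := fun y => Cpower y (- s)%C)); apply: continuous_Cpower; lra.
apply: (is_RInt_derive (fun y => Im (k * Cpower y (RtoC 1 - s))%C)) => x;
  rewrite Rmin_left // Rmax_right // => hx.
  have := proj2 (is_derive_Cpower_comp (RtoC 1 - s)%C k (x := x) ltac:(lra)).
  by rewrite key.
by apply: (continuous_Im (f := fun y => Cpower y (- s)%C)); apply: continuous_Cpower; lra.
Qed.

(** The integral up to [b] differs from the claimed value by [b^(1-s) / (1-s)]. The modulus of
    [b^(1-s)] is the real power of [b] with negative exponent [1 - Re s], so the difference vanishes
    at infinity. *)
Lemma is_RInt_gen_Cpower (s : C) : 1 < Re s ->
  is_RInt_gen (V := C_R_NormedModule) (fun x => Cpower x (- s)%C)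
    (at_point 1) (Rbar_locally p_infty) (RtoC 1 / (s - RtoC 1))%C.
Proof.
move=> hs.
have hs1 : s <> RtoC 1 by move=> h; move: hs; rewrite h /=; lra.
have hs2 : (s - RtoC 1)%C <> RtoC 0.
  by move=> h; apply: hs1; rewrite -[RtoC 1]Cplus_0_r -h; ring.
have hs3 : (RtoC 1 - s)%C <> RtoC 0.
  by move=> h; apply: hs1; rewrite -[s]Cplus_0_r -h; ring.
apply: (is_RInt_gen_p_infty (fun b hb => is_RInt_Cpower hs1 (conj Rlt_0_1 hb))).
apply/filterlim_locally_ball_norm => eps.
have hd : 0 < Cmod (RtoC 1 - s)%C by apply/Cmod_gt_0.
have hed : 0 < eps * Cmod (RtoC 1 - s)%C.
  by apply: Rmult_lt_0_compat => //; exact: cond_pos.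
have := @is_lim_Rpower_neg (1 - Re s) ltac:(lra).
move=> /filterlim_locally/(_ (mkposreal _ hed)) [X hX].
exists (Rmax X 0) => b hb; have [hX1 hX2] := (Rmax_l X 0, Rmax_r X 0).
rewrite /ball_norm.
change (@norm R_AbsRing C_R_NormedModule
  ((Cpower b (RtoC 1 - s) - Cpower 1 (RtoC 1 - s)) / (RtoC 1 - s)
    - RtoC 1 / (s - RtoC 1))%C < eps).
rewrite -Cmod_norm.
have -> : Cpower 1 (RtoC 1 - s)%C = RtoC 1.
  by rewrite /Cpower ln_1 Cmult_0_r -[RtoC 0](Cmult_0_l (RtoC (ln 1))) -/(Cpower 1 _)
    Cpower_0.
have -> : ((Cpower b (RtoC 1 - s) - RtoC 1) / (RtoC 1 - s)
    - RtoC 1 / (s - RtoC 1) = Cpower b (RtoC 1 - s) / (RtoC 1 - s))%C.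
  by field.
rewrite Cmod_div // Cmod_Cpower.
apply/Rlt_div_l => //.
have := hX b ltac:(lra); rewrite /ball /= /AbsRing_ball /abs /minus /plus /opp /=.
by move=> /Rabs_def2; rewrite /Rminus /Re; lra.
Qed.

(** * The modified Hurwitz zeta function: convergence, bounds, shift and continuity *)

Lemma Re_term_le (s : C) (x : R) : Rabs (Re (Cpower x s)) <= Rpower x (Re s).
Proof. by rewrite -Cmod_Cpower; exact: re_le_Cmod. Qed.

Lemma Im_term_le (s : C) (x : R) : Rabs (Im (Cpower x s)) <= Rpower x (Re s).
Proof.
rewrite -Cmod_Cpower; apply: Rle_trans (Rmax_Cmod _); exact: Rmax_r.
Qed.

Lemma ex_series_zeta1 (s : C) (a : R) : 1 < Re s -> -1 < a ->
  ex_series (fun n => Re (Cpower (INR n.+1 + a) (- s)%C)) /\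
  ex_series (fun n => Im (Cpower (INR n.+1 + a) (- s)%C)).
Proof.
move=> hs ha; split; apply: ex_series_le (ex_series_Rpower hs ha) => n.
  exact: Re_term_le.
exact: Im_term_le.
Qed.

(** Each component is at most the real series, and the modulus is at most [sqrt 2] times the larger
    component; 2 is a cruder constant. Taking [b = 0] bounds [zeta1] on [[0, oo)], and [b = a]
    yields its decay. *)
Lemma Cmod_zeta1_le_Series (s : C) (a b : R) : 1 < Re s -> -1 < b <= a ->
  Cmod (zeta1 s a) <= 2 * Series (fun n => Rpower (INR n.+1 + b) (- Re s)).
Proof.
move=> hs [hb hba]; set S := Series _.
have le_S (t : C -> R) : (forall x, Rabs (t (Cpower x (- s)%C)) <= Rpower x (- Re s)) ->
    Rabs (Series (fun n => t (Cpower (INR n.+1 + a) (- s)%C))) <= S.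
  move=> ht.
  have exb := ex_series_Rpower hs hb.
  have le_term n : Rabs (t (Cpower (INR n.+1 + a) (- s)%C))
      <= Rpower (INR n.+1 + b) (- Re s).
    apply: Rle_trans (ht _) _; apply: Rpower_le_base; first lra.
    by have := pos_INR n; rewrite S_INR; lra.
  apply: Rle_trans (Series_Rabs _ _) _.
    apply: ex_series_le exb => n.
    by rewrite /norm /= /abs /= Rabs_Rabsolu; exact: le_term.
  by apply: Series_le => // n; split; [exact: Rabs_pos|exact: le_term].
have hRe := le_S Re (Re_term_le _); have hIm := le_S Im (Im_term_le _).
apply: Rle_trans (Cmod_2Rmax _) _.
have h2 : sqrt 2 <= 2.
  by rewrite -{2}(sqrt_square 2); [apply: sqrt_le_1_alt|]; lra.
apply: Rmult_le_compat => //; first exact: sqrt_pos.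
  exact: Rle_trans (Rabs_pos _) (Rmax_l _ _).
exact: Rmax_lub.
Qed.

(** The first term of the series at [a - 1] is [a^(-s)]; the remaining ones, reindexed, form the
    series at [a]. Positivity of [a] keeps [a - 1] in the domain of convergence. *)
Lemma zeta1_shift (s : C) (a : R) : 1 < Re s -> 0 < a ->
  zeta1 s (a - 1) = (Cpower a (- s) + zeta1 s a)%C.
Proof.
move=> hs ha; have [exRe exIm] := ex_series_zeta1 (a := a - 1) hs ltac:(lra).
have e n : INR n.+2 + (a - 1) = INR n.+1 + a by rewrite (S_INR n.+1); ring.
have e0 : INR 1 + (a - 1) = a by rewrite /=; ring.
rewrite /zeta1 (Series_incr_1 _ exRe) (Series_incr_1 _ exIm) e0.
by rewrite /Cplus /=; congr pair; congr Rplus; apply: Series_ext => n; rewrite e.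
Qed.

Lemma continuous_zeta1 (s : C) (a : R) : 1 < Re s -> -1 < a ->
  continuous (zeta1 s : R -> C_UniformSpace) a.
Proof.
(* The midpoint of -1 and [a]: on the open half-line above [b] the terms are dominated by those of
   the convergent real series at [b]. *)
move=> hs ha; pose b := (a - 1) / 2.
have hb : -1 < b by rewrite /b; lra.
have hba : b < a by rewrite /b; lra.
have cont n x : b < x ->
    continuous (fun y => Cpower (INR n.+1 + y) (- s)%C : C_UniformSpace) x.
  move=> hx; apply: (continuous_comp (fun y => INR n.+1 + y)
    (fun y => Cpower y (- s)%C : C_UniformSpace)).
    apply: (continuous_plus (V := R_NormedModule));
      [exact: continuous_const|exact: continuous_id].
  by apply: continuous_Cpower; have := pos_INR n; rewrite S_INR; lra.
have le_term n x : b < x ->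
    Rpower (INR n.+1 + x) (- Re s) <= Rpower (INR n.+1 + b) (- Re s).
  move=> hx; apply: Rpower_le_base; first lra.
  by have := pos_INR n; rewrite S_INR; lra.
apply: continuous_to_C.
  apply: (continuous_Series (f := fun n x => Re (Cpower (INR n.+1 + x) (- s)%C))
    (@open_gt b) (ex_series_Rpower hs hb)) => // n x hx.
    by apply: Rle_trans (Re_term_le _ _) _; exact: le_term.
  exact: (continuous_Re (f := fun y => Cpower (INR n.+1 + y) (- s)%C) (cont n x hx)).
apply: (continuous_Series (f := fun n x => Im (Cpower (INR n.+1 + x) (- s)%C))
  (@open_gt b) (ex_series_Rpower hs hb)) => // n x hx.
  by apply: Rle_trans (Im_term_le _ _) _; exact: le_term.
exact: (continuous_Im (f := fun y => Cpower (INR n.+1 + y) (- s)%C) (cont n x hx)).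
Qed.

Lemma Cmod_zeta1_lim (s : C) : 1 < Re s ->
  filterlim (fun a => Cmod (zeta1 s a)) (Rbar_locally p_infty) (locally 0).
Proof.
move=> hs; apply/filterlim_locally => eps.
(* Halving [eps] absorbs the factor 2 of [Cmod_zeta1_le_Series]. *)
have /filterlim_locally/(_ (pos_div_2 eps)) [X hX] := is_lim_Rpower_primitive hs.
exists (Rmax X 0) => a ha; have [hX1 hX2] := (Rmax_l X 0, Rmax_r X 0).
have := hX a ltac:(lra).
have h1 := @Cmod_zeta1_le_Series s a a hs ltac:(lra).
have h2 := @Series_Rpower_le (Re s) a hs ltac:(lra).
have h3 := Cmod_ge_0 (zeta1 s a).
rewrite /ball /= /AbsRing_ball /abs /minus /plus /opp /= => /Rabs_def2 h4.
by apply: Rabs_def1; lra.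
Qed.

(** * Finite sums and products of complex numbers *)

HB.instance Definition _ := Monoid.isComLaw.Build C (RtoC 0) Cplus
  Cplus_assoc Cplus_comm Cplus_0_l.
HB.instance Definition _ := Monoid.isComLaw.Build C (RtoC 1) Cmult
  Cmult_assoc Cmult_comm Cmult_1_l.

(** Moving the filter into [G] gives one expansion for all the filtered sums and products; with
    explicit ordinals, conditions such as [i != j] reduce by computation. *)
Lemma big_ord4 (T : Type) (idx : T) (op : Monoid.law idx) (P : pred 'I_4)
    (f : 'I_4 -> T) :
  let G i := if P i then f i else idx in
  \big[op/idx]_(i < 4 | P i) f i =
    op (G (@Ordinal 4 0 isT)) (op (G (@Ordinal 4 1 isT))
      (op (G (@Ordinal 4 2 isT)) (G (@Ordinal 4 3 isT)))).
Proof.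
move=> G; rewrite big_mkcond !big_ord_recl big_ord0 Monoid.mulm1 -/(G _).
by do ![congr (op _ _)]; congr G; apply: val_inj.
Qed.

(** The selected index [k] alone contributes more than 1, and the other terms have positive real
    parts. *)
Lemma Re_sum_gt1 (n : nat) (P : pred 'I_n) (u : 'I_n -> C) (k : 'I_n) :
  (forall i, 1 < Re (u i)) -> P k -> 1 < Re (\sum_(i < n | P i) u i)%C.
Proof.
move=> hu Pk; rewrite (bigD1 k) //=; set S := (\big[_/_]_(_ | _) _).
have hS : 0 <= Re S.
  rewrite /S; apply: (big_ind (fun z => 0 <= Re z)) => [|x y|i _]; first exact: Rle_refl.
    exact: Rplus_le_le_0_compat.
  by move: (hu i); lra.
change (1 < Re (u k) + Re S); move: (hu k); lra.
Qed.

(** A class closed under products and containing each [zeta1 s] with [1 < Re s]; its members are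
    integrable on [[1, oo)] once multiplied by a power [a^(-s)] of this kind. *)
Definition bounded_continuous (g : R -> C) :=
  (forall a, 0 <= a -> continuous (g : R -> C_UniformSpace) a) /\
  exists K, forall a, 0 <= a -> Cmod (g a) <= K.

Lemma bounded_continuous_mult (f g : R -> C) :
  bounded_continuous f -> bounded_continuous g ->
  bounded_continuous (fun a => f a * g a)%C.
Proof.
move=> [cf [K hK]] [cg [L hL]]; split.
  by move=> a ha; apply: continuous_Cmult; [exact: cf|exact: cg].
exists (K * L) => a ha; rewrite Cmod_mult.
by apply: Rmult_le_compat; [exact: Cmod_ge_0|exact: Cmod_ge_0|exact: hK|exact: hL].
Qed.

Lemma bounded_continuous_zeta1 (s : C) : 1 < Re s -> bounded_continuous (zeta1 s).
Proof.
move=> hs; split; first by move=> a ha; apply: continuous_zeta1 => //; lra.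
eexists => a ha; exact: (@Cmod_zeta1_le_Series s a 0 hs ltac:(lra)).
Qed.

Lemma bounded_continuous_prod (n : nat) (P : pred 'I_n) (f : 'I_n -> R -> C) :
  (forall i, bounded_continuous (f i)) ->
  bounded_continuous (fun a => \prod_(i < n | P i) f i a)%C.
Proof.
move=> hf; elim: (index_enum _) => [|i r IH].
  split=> [a _|].
    apply: (continuous_ext (fun=> RtoC 1)) => [y|]; first by rewrite big_nil.
    exact: continuous_const.
  by exists 1 => a _; rewrite big_nil Cmod_1; lra.
case Pi: (P i); last first.
  move: IH => [cr [K hK]]; split.
    move=> a ha; apply: continuous_ext (cr a ha) => y.
    by rewrite big_cons Pi.
  by exists K => a ha; rewrite big_cons Pi; exact: hK.
have [cr [K hK]] := bounded_continuous_mult (hf i) IH; split.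
  by move=> a ha; apply: continuous_ext (cr a ha) => y; rewrite big_cons Pi.
by exists K => a ha; rewrite big_cons Pi; exact: hK.
Qed.

(** * Convergence and additivity of the improper integrals *)

Lemma ex_CInt1oo_Cpower_mult (s : C) (g : R -> C) :
  1 < Re s -> bounded_continuous g ->
  ex_CInt1oo (fun a => Cpower a (- s) * g a)%C.
Proof.
move=> hs [cg [K hK]].
(* The dominating function is [K] times [x^(- Re s)], with [K] a bound of [g]; [G] is [K] times its
   primitive vanishing at infinity. *)
apply: (ex_RInt_gen_dominated (V := C_R_CompleteNormedModule)
  (g := fun x => scal K (Rpower x (- Re s)))
  (G := fun x => scal K (- (Rpower x (1 - Re s) / (Re s - 1))))
  (l := scal K 0)).
- move=> b hb; apply: (ex_RInt_continuous (V := C_R_CompleteNormedModule)) => z.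
  rewrite Rmin_left // => hz; apply: continuous_Cmult; last by apply: cg; lra.
  by apply: continuous_Cpower; lra.
- move=> x hx.
  change (@norm R_AbsRing C_R_NormedModule (Cpower x (- s) * g x)%C
    <= K * Rpower x (- Re s)).
  rewrite -Cmod_norm Cmod_mult Cmod_Cpower Rmult_comm.
  apply: Rmult_le_compat_r; first by apply/Rlt_le/exp_pos.
  by apply: hK; lra.
- move=> x y hxy.
  have := is_RInt_scal _ _ _ K _ (@is_RInt_Rpower (Re s) x y hs ltac:(lra)).
  by rewrite /scal /= /mult /= Rmult_minus_distr_l.
apply: filterlim_comp (filterlim_scal_r _ _); exact: is_lim_Rpower_primitive.
Qed.

Lemma CInt1oo_correct (f : R -> C) : ex_CInt1oo f ->
  is_RInt_gen (V := C_R_NormedModule) f (at_point 1) (Rbar_locally p_infty)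
    (CInt1oo f).
Proof.
move=> hf.
exact (@RInt_gen_correct C_R_CompleteNormedModule _ _ _ _ f hf).
Qed.

Lemma is_RInt_gen_Cplus (f g : R -> C) (k l : C) :
  is_RInt_gen (V := C_R_NormedModule) f (at_point 1) (Rbar_locally p_infty) k ->
  is_RInt_gen (V := C_R_NormedModule) g (at_point 1) (Rbar_locally p_infty) l ->
  is_RInt_gen (V := C_R_NormedModule) (fun a => f a + g a)%C
    (at_point 1) (Rbar_locally p_infty) (k + l)%C.
Proof. exact: (is_RInt_gen_plus (V := C_R_NormedModule)). Qed.

Lemma is_RInt_gen_sum (n : nat) (P : pred 'I_n) (f : 'I_n -> R -> C)
    (l : 'I_n -> C) :
  (forall i, P i -> is_RInt_gen (V := C_R_NormedModule) (f i)
    (at_point 1) (Rbar_locally p_infty) (l i)) ->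
  is_RInt_gen (V := C_R_NormedModule) (fun a => \sum_(i < n | P i) f i a)%C
    (at_point 1) (Rbar_locally p_infty) (\sum_(i < n | P i) l i)%C.
Proof.
move=> hf; elim: (index_enum _) => [|i r IH].
  rewrite big_nil.
  apply: (is_RInt_gen_p_infty (F := fun=> RtoC 0 : C_R_NormedModule)).
    move=> b hb; have := is_RInt_const (V := C_R_NormedModule) 1 b (RtoC 0).
    rewrite (scal_zero_r (V := C_R_NormedModule)).
    by apply: is_RInt_ext => x _; rewrite big_nil.
  exact: filterlim_const.
have ext (g h : R -> C) L : (forall x, g x = h x) ->
    is_RInt_gen (V := C_R_NormedModule) g (at_point 1) (Rbar_locally p_infty) L ->
    is_RInt_gen (V := C_R_NormedModule) h (at_point 1) (Rbar_locally p_infty) L.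
  by move=> e; apply: is_RInt_gen_ext; apply: filter_forall => ab x _; exact: e.
rewrite big_cons; case Pi: (P i); last first.
  by apply: ext IH => x; rewrite big_cons Pi.
apply: ext (is_RInt_gen_plus _ _ _ _ (hf i Pi) IH) => x.
by rewrite big_cons Pi.
Qed.

(** The first factor tends to 0 and the product of the others is bounded; the index type is nonempty
    so that a first factor exists. *)
Lemma prod_zeta1_lim (n : nat) (u : 'I_n.+1 -> C) : (forall i, 1 < Re (u i)) ->
  filterlim (fun a => Cmod (\prod_(i < n.+1) zeta1 (u i) a)%C)
    (Rbar_locally p_infty) (locally 0).
Proof.
move=> hu.
have [_ [K hK]] := @bounded_continuous_prod n predT
  (fun i => zeta1 (u (lift ord0 i))) (fun i => bounded_continuous_zeta1 (hu _)).
have lim := Cmod_zeta1_lim (hu ord0).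
apply: (filterlim_le_le (fun=> 0) _ (fun a => scal K (Cmod (zeta1 (u ord0) a))) 0).
- exists 0 => a ha; split; first exact: Cmod_ge_0.
  rewrite big_ord_recl Cmod_mult Rmult_comm.
  by apply: Rmult_le_compat_r; [exact: Cmod_ge_0|apply: hK; lra].
- exact: filterlim_const.
have -> : Rbar_locally 0 = locally (scal K 0) by rewrite /= /scal /= /mult /= Rmult_0_r.
exact: filterlim_comp lim (filterlim_scal_r _ _).
Qed.

(** Since [RInt] and [RInt_gen] are total, the identity alone would not assert convergence; the
    integrability claims accompany it for this reason. *)
Theorem lemma5 (u : 'I_4 -> C) (hu : forall i : 'I_4, 1 < Re (u i)) :
  ex_CInt01 (fun a : R => \prod_(i < 4) zeta1 (u i) a)%C /\
  (forall j : 'I_4,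
     ex_CInt1oo (fun a : R =>
       Cpower a (- \sum_(i < 4 | i != j) u i) * zeta1 (u j) a)%C) /\
  (forall j k : 'I_4, (j < k)%N ->
     ex_CInt1oo (fun a : R =>
       Cpower a (- \sum_(i < 4 | (i != j) && (i != k)) u i)
       * zeta1 (u j) a * zeta1 (u k) a)%C) /\
  (forall j : 'I_4,
     ex_CInt1oo (fun a : R =>
       Cpower a (- u j) * \prod_(i < 4 | i != j) zeta1 (u i) a)%C) /\
  (CInt01 (fun a : R => \prod_(i < 4) zeta1 (u i) a)
   = RtoC 1 / (\sum_(i < 4) u i - RtoC 1)
     + \sum_(j < 4)
         CInt1oo (fun a : R =>
           Cpower a (- \sum_(i < 4 | i != j) u i) * zeta1 (u j) a)
     + \sum_(j < 4) \sum_(k < 4 | (j < k)%N)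
         CInt1oo (fun a : R =>
           Cpower a (- \sum_(i < 4 | (i != j) && (i != k)) u i)
           * zeta1 (u j) a * zeta1 (u k) a)
     + \sum_(j < 4)
         CInt1oo (fun a : R =>
           Cpower a (- u j) * \prod_(i < 4 | i != j) zeta1 (u i) a))%C.
Proof.
pose F a := (\prod_(i < 4) zeta1 (u i) a)%C.
have hz i := bounded_continuous_zeta1 (hu i).
have [contF _] : bounded_continuous F by exact: bounded_continuous_prod.
have exF : ex_CInt01 F.
  apply: (ex_RInt_continuous (V := C_R_CompleteNormedModule)) => z.
  rewrite Rmin_left; last lra.
  by move=> hz0; apply: contF; lra.
(* Two indices cannot exhaust four, so every exponent sum below is nonempty and has real part above
   1. The case [j = k] serves the sums omitting a single index. *)
have other (j k : 'I_4) : exists i, (i != j) && (i != k).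
  have /card_gt0P [i] : (0 < #|~: [set j; k]|)%N.
    by rewrite -(ltn_add2l #|[set j; k]|) cardsC card_ord cards2; case: (_ != _).
  by rewrite !inE negb_or; exists i.
have ex1 (j : 'I_4) : ex_CInt1oo (fun a =>
    Cpower a (- \sum_(i < 4 | i != j) u i) * zeta1 (u j) a)%C.
  apply: ex_CInt1oo_Cpower_mult => //.
  have [k /andP [kj _]] := other j j; exact: (Re_sum_gt1 hu kj).
have ex2 (j k : 'I_4) : ex_CInt1oo (fun a =>
    Cpower a (- \sum_(i < 4 | (i != j) && (i != k)) u i)
      * zeta1 (u j) a * zeta1 (u k) a)%C.
  apply: (@ex_RInt_gen_ext_eq C_R_NormedModule _ _ _ _ (fun a =>
    Cpower a (- \sum_(i < 4 | (i != j) && (i != k)) u i)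
      * (zeta1 (u j) a * zeta1 (u k) a))%C).
    by move=> a; rewrite Cmult_assoc.
  apply: ex_CInt1oo_Cpower_mult; last exact: bounded_continuous_mult.
  have [i hi] := other j k; exact: (Re_sum_gt1 hu hi).
have ex3 (j : 'I_4) : ex_CInt1oo (fun a =>
    Cpower a (- u j) * \prod_(i < 4 | i != j) zeta1 (u i) a)%C.
  by apply: ex_CInt1oo_Cpower_mult => //; exact: bounded_continuous_prod.
do 4![split=> //].
set rhs := (X in _ = X).
(* The integral of [D] over [[1, oo)] is computed twice, as [CInt01 F] by the unit shift and as
   [rhs] by expansion; uniqueness of the value concludes. *)
pose D a := minus (F (a - 1) : C_R_NormedModule) (F a).
have hF : is_RInt_gen D (at_point 1) (Rbar_locally p_infty) (CInt01 F).
  apply: (is_RInt_gen_unit_shift (V := C_R_CompleteNormedModule) contF).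
  by apply: filterlim_ext (prod_zeta1_lim hu) => a; exact: Cmod_norm.
suff hrhs : is_RInt_gen D (at_point 1) (Rbar_locally p_infty) rhs.
  transitivity (CInt1oo D); first symmetry.
    exact: (is_RInt_gen_unique (V := C_R_CompleteNormedModule) _ _ hF).
  exact: (is_RInt_gen_unique (V := C_R_CompleteNormedModule) _ _ hrhs).
have hS : 1 < Re (\sum_(i < 4) u i)%C := @Re_sum_gt1 4 predT u ord0 hu isT.
pose G a := (Cpower a (- (\sum_(i < 4) u i))
  + \sum_(j < 4) (Cpower a (- \sum_(i < 4 | i != j) u i) * zeta1 (u j) a)
  + \sum_(j < 4) \sum_(k < 4 | (j < k)%N)
      (Cpower a (- \sum_(i < 4 | (i != j) && (i != k)) u i)
           * zeta1 (u j) a * zeta1 (u k) a)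
  + \sum_(j < 4) (Cpower a (- u j) * \prod_(i < 4 | i != j) zeta1 (u i) a))%C.
have hG : is_RInt_gen (V := C_R_NormedModule) G (at_point 1)
    (Rbar_locally p_infty) rhs.
  apply: is_RInt_gen_Cplus; last first.
    by apply: is_RInt_gen_sum => j _; exact: CInt1oo_correct.
  apply: is_RInt_gen_Cplus; last first.
    apply: is_RInt_gen_sum => j _; apply: is_RInt_gen_sum => k _.
    exact: CInt1oo_correct.
  apply: is_RInt_gen_Cplus; first exact: is_RInt_gen_Cpower.
  by apply: is_RInt_gen_sum => j _; exact: CInt1oo_correct.
apply: (is_RInt_gen_ext (V := C_R_NormedModule) G D) hG.
(* With these endpoints [G] and [D] need only agree for [a > 1], where [zeta1_shift] applies. *)
exists (fun x => x = 1) (fun y => 1 < y).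
- by [].
- by exists 1.
move=> x y -> hy a; rewrite /= Rmin_left; last lra; move=> [ha _].
change (G a = F (Rminus a 1) - F a)%C.
have -> : F (a - 1) = (\prod_(i < 4) (Cpower a (- u i) + zeta1 (u i) a))%C.
  by apply: eq_bigr => i _; apply: zeta1_shift => //; lra.
(* Powers of sums split into products of the [Cpower a (- u i)], and each index filtered out leaves
   a zero exponent, hence a factor 1. What remains is a polynomial identity in four powers and four
   zeta values. *)
have CpowerND s t : Cpower a (- (s + t))%C = (Cpower a (- s) * Cpower a (- t))%C.
  by rewrite Copp_plus_distr Cpower_plus.
have CpowerN0 : Cpower a (- RtoC 0)%C = RtoC 1 by rewrite Copp_0 Cpower_0.
rewrite /F /G !big_ord4 /= !CpowerND !CpowerN0.
ring.
Qed.
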